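(* Let $(X,f_{1,\infty})$ be a nonautonomous dynamical system, and let $K$ be a nonempty subset of $X$. Then for any $k\in\mathbb{N}$, $$D(f_{1,\infty}^k,K)\le D(f_{1,\infty},K).$$
   Context: $\mathbb{N}=\{1,2,\dots\}$. A nonautonomous dynamical system $(X,f_{1,\infty})$ consists of a compact topological space $X$ and a sequence $f_{1,\infty}=(f_i)_{i\ge 1}$ of continuous maps $f_i:X\to X$. Put $f_i^0=\mathrm{id}_X$ and $f_i^j=f_{i+j-1}\circ\cdots\circ f_{i+1}\circ f_i$. For $k\in\mathbb{N}$, $f_{1,\infty}^k$ denotes the sequence of maps $(f_1^k,f_{k+1}^k,f_{2k+1}^k,\dots)$. Pesin topological entropy dimension of a sequence $g_{1,\infty}=(g_i)_{i\ge1}$ of continuous selfmaps of $X$ on nonempty $K\subseteq X$ (applied above to $g_{1,\infty}=f_{1,\infty}$ and $f_{1,\infty}^k$). Put $g_1^0=\mathrm{id}_X$, $g_1^j=g_j\circ\cdots\circ g_1$. For a finite open cover $\mathcal{U}$ of $X$, let $S(\mathcal{U})$ be the set of all finite strings $\mathbf{U}=(U_{i_0},\dots,U_{i_{m-1}})$ of elements of $\mathcal{U}$, with length $m(\mathbf{U})=m$, and let $X(\mathbf{U})=\{x\in X: g_1^j(x)\in U_{i_j},\ 0\le j\le m(\mathbf{U})-1\}$. A collection $\mathcal{G}\subseteq S(\mathcal{U})$ covers $K$ if $K\subseteq\bigcup_{\mathbf{U}\in\mathcal{G}}X(\mathbf{U})$. For $\alpha\in\mathbb{R}$, $s>0$ let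 $M(g_{1,\infty},K,s,\mathcal{U},\alpha,N)=\inf_{\mathcal{G}}\sum_{\mathbf{U}\in\mathcal{G}}e^{-\alpha m(\mathbf{U})^s}$, the infimum over all finite or countable $\mathcal{G}\subseteq S(\mathcal{U})$ covering $K$ with $m(\mathbf{U})\ge N$ for all $\mathbf{U}\in\mathcal{G}$. Let $m(g_{1,\infty},K,s,\mathcal{U},\alpha)=\lim_{N\to\infty}M(g_{1,\infty},K,s,\mathcal{U},\alpha,N)$, $D(g_{1,\infty},K,s,\mathcal{U})=\inf\{\alpha: m(g_{1,\infty},K,s,\mathcal{U},\alpha)=0\}=\sup\{\alpha: m(g_{1,\infty},K,s,\mathcal{U},\alpha)=\infty\}$, and $D(g_{1,\infty},K,s)=\sup_{\mathcal{U}}D(g_{1,\infty},K,s,\mathcal{U})$ over finite open covers $\mathcal{U}$ of $X$. Then $D(g_{1,\infty},K)=\sup\{s>0:D(g_{1,\infty},K,s)=+\infty\}=\inf\{s>0:D(g_{1,\infty},K,s)=0\}$, with $\inf\emptyset=+\infty$ and $\sup\emptyset=0$ for sets of $s>0$. *)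

(* Defs.v *)
From HB Require Import structures.
From mathcomp Require Import all_boot all_order all_algebra.
From mathcomp Require Import all_classical all_reals all_analysis.
From mathcomp Require Import lra.
Set Implicit Arguments.
Unset Strict Implicit.
Unset Printing Implicit Defensive.
Import Order.TTheory GRing.Theory Num.Theory.
Local Open Scope classical_set_scope.
Local Open Scope ring_scope.

(* Sequences of maps are indexed from 0: [f n] is the map written f_{n+1} when
   indices start at 1.  Thus [nds_comp f i j] is f_{i+1}^j, i.e.
   f_{i+j} o ... o f_{i+1}. *)
Fixpoint nds_comp (X : Type) (f : nat -> X -> X) (i j : nat) : X -> X :=
  if j is j'.+1 then f (i + j')%N \o nds_comp f i j' else id.

Definition nds_power (X : Type) (f : nat -> X -> X) (k : nat) : nat -> X -> X :=
  fun n => nds_comp f (n * k) k.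

Definition finite_open_cover (X : topologicalType) (U : set (set X)) : Prop :=
  [/\ finite_set U, (forall A, U A -> open A) & \bigcup_(A in U) A = [set: X]].

Definition strings (X : Type) (U : set (set X)) : set (seq (set X)) :=
  [set u | (0 < size u)%N /\ forall j, (j < size u)%N -> U (nth set0 u j)].

Definition string_set (X : Type) (g : nat -> X -> X) (u : seq (set X)) : set X :=
  [set x | forall j, (j < size u)%N -> nth set0 u j (nds_comp g 0 j x)].

Definition string_covers (X : Type) (g : nat -> X -> X) (K : set X)
    (U : set (set X)) (N : nat) (G : set (seq (set X))) : Prop :=
  [/\ countable G, G `<=` strings U, (forall u, G u -> (N <= size u)%N)
    & K `<=` \bigcup_(u in G) string_set g u].

Section pesin_dimension.
Context {R : realType} {X : topologicalType}.
Implicit Types (g : nat -> X -> X) (K : set X) (U : set (set X)) (s a : R).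

Definition pesin_M g K s U a (N : nat) : \bar R :=
  ereal_inf [set \esum_(u in G) (expR (- a * (size u)%:R `^ s))%:E
            | G in string_covers g K U N].

Definition pesin_m g K s U a : \bar R := limn (pesin_M g K s U a).

(* For [s > 0] this is also the supremum of the [a] with
   [pesin_m g K s U a = +oo], see [pesin_D_cover_sup]. *)
Definition pesin_D_cover g K s U : \bar R :=
  ereal_inf [set a%:E | a in [set a | pesin_m g K s U a = 0%E]].

Definition pesin_D g K s : \bar R :=
  ereal_sup [set pesin_D_cover g K s U | U in @finite_open_cover X].

(* For nonempty [K] this is also the supremum of the [s > 0] with
   [pesin_D g K s = +oo], the empty supremum being 0, see [pesin_dim_sup]. *)
Definition pesin_dim g K : \bar R :=
  ereal_inf [set s%:E | s in [set s | 0 < s /\ pesin_D g K s = 0%E]].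

Lemma pesin_M_ge0 g K s U a N : (0 <= pesin_M g K s U a N)%E.
Proof.
apply: le_ereal_inf_tmp => _ [G _ <-]; apply: esum_ge0 => u _.
by rewrite lee_fin expR_ge0.
Qed.

Lemma pesin_M_nd g K s U a :
  {homo pesin_M g K s U a : N N' / (N <= N')%N >-> (N <= N')%E}.
Proof.
move=> N N' NN'; apply: ereal_inf_le_tmp => _ [G [cG GU GN KG] <-].
by exists G => //; split => // u Gu; apply: leq_trans NN' (GN u Gu).
Qed.

Lemma pesin_M_le_m g K s U a N : (pesin_M g K s U a N <= pesin_m g K s U a)%E.
Proof.
rewrite /pesin_m (cvg_lim _ (ereal_nondecreasing_cvgn _)) //.
  by apply: ereal_sup_ubound; exists N.
by move=> ? ? ?; exact: pesin_M_nd.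
Qed.

Lemma pesin_m_le g K s U a (b : \bar R) N0 :
  (forall N, (N0 <= N)%N -> (pesin_M g K s U a N <= b)%E) ->
  (pesin_m g K s U a <= b)%E.
Proof.
move=> H; rewrite /pesin_m (cvg_lim _ (ereal_nondecreasing_cvgn _)) //.
  apply: ge_ereal_sup => _ [N _ <-].
  apply: (@le_trans _ _ (pesin_M g K s U a (maxn N N0))).
    by apply: pesin_M_nd; exact: leq_maxl.
  by apply: H; exact: leq_maxr.
by move=> ? ? ?; exact: pesin_M_nd.
Qed.

Lemma pesin_m_ge0 g K s U a : (0 <= pesin_m g K s U a)%E.
Proof. exact: le_trans (pesin_M_ge0 _ _ _ _ _ 0) (pesin_M_le_m _ _ _ _ _ _). Qed.

Lemma exists_powR_ge s (x : R) : 0 < s ->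
  exists N0 : nat, forall n, (N0 <= n)%N -> x <= n%:R `^ s.
Proof.
move=> s0; exists (Num.truncn (Num.max x 0 `^ s^-1)).+1 => n nN.
have x0 : 0 <= Num.max x 0 by rewrite le_max lexx orbT.
apply: (@le_trans _ _ (Num.max x 0)); first by rewrite le_max lexx.
rewrite -[leLHS](powRr1 x0) -[X in _ `^ X](mulVf (lt0r_neq0 s0)) powRrM.
apply: ge0_ler_powR; rewrite ?nnegrE ?powR_ge0 ?ler0n ?(ltW s0) //.
apply: ltW.
by apply: lt_le_trans (truncnS_gt _) _; rewrite ler_nat.
Qed.

Lemma esum_expR_le s (a b : R) (N : nat) (C : R) (G : set (seq (set X))) :
  0 < s -> a <= b -> (forall u, G u -> (N <= size u)%N) ->
  (\esum_(u in G) (expR (- a * (size u)%:R `^ s))%:E <= C%:E)%E ->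
  (\esum_(u in G) (expR (- b * (size u)%:R `^ s))%:E
     <= (expR (- (b - a) * N%:R `^ s) * C)%:E)%E.
Proof.
move=> s0 ab GN aC; apply: ge_ereal_sup => _ [F [finF FG] <-].
rewrite fsumEFin // lee_fin.
have FC : \sum_(u \in F) expR (- a * (size u)%:R `^ s) <= C.
  rewrite -lee_fin; apply: le_trans aC; rewrite -fsumEFin //.
  by apply: ereal_sup_ubound; exists F.
apply: le_trans (ler_wpM2l (expR_ge0 _) FC).
rewrite mulr_fsumr !fsbig_finite //= big_seq [leRHS]big_seq.
apply: ler_sum => u; rewrite in_fset_set // inE => Fu.
rewrite -expRD ler_expR.
have uN : N%:R `^ s <= (size u)%:R `^ s :> R.
  apply: ge0_ler_powR; rewrite ?nnegrE ?ler0n ?(ltW s0) //.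
  by rewrite ler_nat GN //; exact: FG.
have : (b - a) * N%:R `^ s <= (b - a) * (size u)%:R `^ s.
  by rewrite ler_wpM2l // subr_ge0.
by lra.
Qed.

Lemma pesin_m_eq0 g K s U (a b : R) : 0 < s -> a < b ->
  (pesin_m g K s U a < +oo)%E -> pesin_m g K s U b = 0%E.
Proof.
move=> s0 ab moo; apply/eqP; rewrite eq_le pesin_m_ge0 andbT.
have mfin : pesin_m g K s U a \is a fin_num by rewrite ge0_fin_numE ?pesin_m_ge0.
set C := fine (pesin_m g K s U a) + 1.
have mC : (pesin_m g K s U a < C%:E)%E.
  by rewrite -(fineK mfin) lte_fin ltrDl.
have C0 : 0 < C by rewrite -lte_fin (le_lt_trans _ mC) ?pesin_m_ge0.
have MC N : (pesin_M g K s U b N <= (expR (- (b - a) * N%:R `^ s) * C)%:E)%E.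
  have /ereal_inf_lt[_ [G GN <-] GC] := le_lt_trans (pesin_M_le_m g K s U a N) mC.
  apply: (@le_trans _ _ (\esum_(u in G) (expR (- b * (size u)%:R `^ s))%:E)%E).
    by apply: ereal_inf_lbound; exists G.
  by case: GN => ? ? ? ?; apply: esum_expR_le (ltW GC) => //; exact: ltW.
apply/lee_addgt0Pr => e e0; rewrite add0e.
have ba : 0 < b - a by rewrite subr_gt0.
have [N0 HN0] := exists_powR_ge (- ln (e / C) / (b - a)) s0.
apply: (@pesin_m_le _ _ _ _ _ _ N0) => N NN0; apply: le_trans (MC N) _.
rewrite lee_fin -ler_pdivlMr // -[leRHS]lnK ?posrE ?divr_gt0 // ler_expR.
by have := HN0 N NN0; rewrite ler_pdivrMr //; lra.
Qed.

Lemma ereal_between (x y : \bar R) : (x < y)%E ->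
  exists r : R, (x < r%:E)%E /\ (r%:E < y)%E.
Proof.
case: x => [x| |]; case: y => [y| |] //=.
- by rewrite lte_fin => xy; exists ((x + y) / 2); rewrite !lte_fin !midf_lt.
- by move=> _; exists (x + 1); rewrite ltry lte_fin ltrDl.
- by move=> _; exists (y - 1); rewrite ltNyr lte_fin gtrDl ltrN10.
- by move=> _; exists 0; rewrite ltNyr ltry.
Qed.

Lemma pesin_D_cover_sup g K s U : 0 < s ->
  pesin_D_cover g K s U =
  ereal_sup [set a%:E | a in [set a | pesin_m g K s U a = +oo%E]].
Proof.
move=> s0; apply/eqP; rewrite eq_le; apply/andP; split.
  rewrite leNgt; apply/negP => /ereal_between[r [rl /ereal_between[q [rq ql]]]].
  move: ql; rewrite ltNge => /negP; apply; apply: ereal_inf_lbound; exists q => //=.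
  apply: (@pesin_m_eq0 _ _ _ _ r) => //.
  rewrite ltey; apply/eqP => mr; move: rl; rewrite ltNge => /negP; apply.
  by apply: ereal_sup_ubound; exists r.
apply: ge_ereal_sup => _ [a /= ma <-]; apply: le_ereal_inf_tmp => _ [b /= mb <-].
rewrite lee_fin leNgt; apply/negP => ba.
by move: ma; rewrite (pesin_m_eq0 s0 ba) // mb ltry.
Qed.

Lemma pesin_D_cover_ge0 g K s U : K !=set0 -> (0 <= pesin_D_cover g K s U)%E.
Proof.
move=> [x Kx]; apply: le_ereal_inf_tmp => _ [a /= ma <-].
rewrite lee_fin leNgt; apply/negP => a0.
suff : (1 <= pesin_m g K s U a)%E by rewrite ma lee_fin ler10.
apply: le_trans (pesin_M_le_m g K s U a 0).
apply: le_ereal_inf_tmp => _ [G [cG GU GN KG] <-].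
have [u Gu _] := KG x Kx.
apply: esum_ge; exists [set u]; first by split => // v ->.
rewrite fsbig_set1 lee_fin -expR0 ler_expR mulr_ge0 ?powR_ge0 //.
by rewrite oppr_ge0 ltW.
Qed.

Lemma finite_open_coverT : finite_open_cover [set [set: X]].
Proof.
split; first exact: finite_set1.
- by move=> A ->; exact: openT.
- by rewrite bigcup_set1.
Qed.

Lemma pesin_D_ge0 g K s : K !=set0 -> (0 <= pesin_D g K s)%E.
Proof.
move=> K0; apply: le_ereal_sup_tmp; exists (pesin_D_cover g K s [set [set: X]]).
  by exists [set [set: X]] => //; exact: finite_open_coverT.
exact: pesin_D_cover_ge0.
Qed.

Lemma pesin_D_eq0 g K (s t : R) : K !=set0 -> 0 < s -> s < t ->
  (pesin_D g K s < +oo)%E -> pesin_D g K t = 0%E.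
Proof.
move=> K0 s0 st Ds; apply/eqP; rewrite eq_le pesin_D_ge0 // andbT.
apply: ge_ereal_sup => _ [U cU <-].
have /ereal_inf_lt[_ [a /= ma <-] _] : (pesin_D_cover g K s U < +oo)%E.
  by apply: le_lt_trans Ds; apply: ereal_sup_ubound; exists U.
apply/lee_addgt0Pr => e e0; rewrite add0e; apply: ereal_inf_lbound.
exists e; last by [].
rewrite /mkset; apply/eqP; rewrite eq_le pesin_m_ge0 andbT.
have ts : 0 < t - s by rewrite subr_gt0.
have [N0 HN0] := exists_powR_ge (a / e) ts.
apply: (@pesin_m_le _ _ _ _ _ _ N0.+1) => N NN0.
rewrite -ma; apply: le_trans (pesin_M_le_m g K s U a N).
apply: le_ereal_inf_tmp => _ [G GN <-].
apply: (@le_trans _ _ (\esum_(u in G) (expR (- e * (size u)%:R `^ t))%:E)%E).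
  by apply: ereal_inf_lbound; exists G.
case: GN => _ _ GN _; apply: le_esum => u Gu.
rewrite lee_fin ler_expR !mulNr lerN2.
have uN : (N0 < size u)%N by apply: leq_trans (GN u Gu).
have -> : (size u)%:R `^ t = (size u)%:R `^ (t - s) * (size u)%:R `^ s :> R.
  rewrite -powRD ?subrK //; apply/implyP => _.
  by rewrite pnatr_eq0 -lt0n (leq_ltn_trans _ uN).
rewrite mulrA ler_wpM2r ?powR_ge0 // mulrC -ler_pdivrMr //.
exact: HN0 (ltnW uN).
Qed.

Lemma pesin_dim_sup g K : K !=set0 ->
  pesin_dim g K =
  ereal_sup (0%E |` [set s%:E | s in [set s | 0 < s /\ pesin_D g K s = +oo%E]]).
Proof.
move=> K0; apply/eqP; rewrite eq_le; apply/andP; split.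
  rewrite leNgt; apply/negP => /ereal_between[r [rl /ereal_between[q [rq ql]]]].
  have r0 : 0 < r.
    by rewrite -lte_fin; apply: le_lt_trans rl; apply: ereal_sup_ubound; left.
  have {}rq : r < q by rewrite -lte_fin.
  move: ql; rewrite ltNge => /negP; apply; apply: ereal_inf_lbound; exists q => //=.
  split; first exact: lt_trans rq.
  apply: (@pesin_D_eq0 _ _ r) => //.
  rewrite ltey; apply/eqP => mr; move: rl; rewrite ltNge => /negP; apply.
  by apply: ereal_sup_ubound; right; exists r.
apply: le_ereal_inf_tmp => _ [b /= [b0 mb] <-]; apply: ge_ereal_sup.
move=> _ [->|[a /= [a0 ma] <-]]; first by rewrite lee_fin ltW.
rewrite lee_fin leNgt; apply/negP => ba.
by move: ma; rewrite (pesin_D_eq0 K0 b0 ba) // mb ltry.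
Qed.

End pesin_dimension.

(* Main.v *)
Require Import Defs.
From HB Require Import structures.
From mathcomp Require Import all_boot all_order all_algebra.
From mathcomp Require Import all_classical all_reals all_analysis.
Import Order.TTheory GRing.Theory Num.Theory.
Local Open Scope classical_set_scope.
Local Open Scope ring_scope.

(** One step of the power system is [k] steps of [f].  So a string [u] read by
    [f] forces, on the same points, the string formed by every [k]-th letter of
    [u] when read by [nds_power f k] ([string_set_decimate]); the open cover is
    the same for both systems.  The shorter string has length [m'] between
    [m / k] and [m / k + 1], where [m] is the length of [u]; hence
    [b * m' ^ s >= (b / k ^ s) * m ^ s] for [b >= 0], and decimating all the
    strings of a cover can only decrease the sum of weights, provided the
    exponent [b] is replaced by [b / k ^ s] for [f].  This bounds [pesin_m] of
    the power system at [b] by [pesin_m] of [f] at [b / k ^ s]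
    ([pesin_m_nds_power_le]).

    Only the vanishing of [pesin_D] matters for the dimension, and the factor
    [k ^ s] is invisible there: if [pesin_D f K s] is zero, then for each open
    cover [pesin_m] of [f] vanishes at [b / k ^ s] for every [b > 0], so that
    [pesin_m] of the power system vanishes at every [b > 0].  Thus each [s]
    admissible in the infimum defining the dimension of [f] is admissible for
    the power system. *)

(** An image may be covered several times, which only increases the right-hand
    side: a section of [e] picks one preimage for each point of the image. *)
Lemma esum_image_le (R : realType) (T T' : choiceType) (P : set T)
    (e : T -> T') (a : T' -> \bar R) : (forall i, P i -> 0 <= a (e i))%E ->
  (\esum_(j in e @` P) a j <= \esum_(i in P) a (e i))%E.
Proof.
move=> a0; have [->|/set0P[i0 Pi0]] := eqVneq P set0.
  by rewrite image_set0 !esum_set0.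
pose h j := xget i0 [set i | P i /\ e i = j].
have hP j : (e @` P) j -> P (h j) /\ e (h j) = j.
  by case=> i Pi eij; rewrite /h; case: xgetP => [x _ [] //|/(_ i)[]].
rewrite (reindex_esum (h @` (e @` P)) _ e); last first.
  split.
  - by move=> _ [j Pj <-]; rewrite (hP j Pj).2.
  - move=> x y; rewrite !inE => -[j Pj <-] [j' Pj' <-].
    by rewrite (hP j Pj).2 (hP j' Pj').2 => ->.
  - by move=> j Pj; exists (h j); [exists j | exact: (hP j Pj).2].
apply: ge_ereal_sup => _ [F [finF FP] <-].
apply: ereal_sup_ubound; exists F => //; split => // i /FP [j Pj <-].
exact: (hP j Pj).1.
Qed.

Section decimation.
Context {X : Type}.
Implicit Types (f : nat -> X -> X) (U : set (set X)) (u : seq (set X)).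

Lemma nds_compD f i a b :
  nds_comp f i (a + b) = nds_comp f (i + a) b \o nds_comp f i a.
Proof.
elim: b => [|b IHb]; first by rewrite addn0.
by rewrite addnS /= IHb addnA.
Qed.

Lemma nds_comp_power f k j :
  nds_comp (nds_power f k) 0 j = nds_comp f 0 (j * k).
Proof.
elim: j => [//|j IHj] /=.
by rewrite IHj mulSnr nds_compD !add0n.
Qed.

(** The letters of [u] at the positions [0, k, 2 * k, ...] below [size u]; for
    nonempty [u], there are [(size u).-1 %/ k + 1] of them. *)
Definition decimate k u :=
  mkseq (fun j => nth set0 u (j * k)) ((size u).-1 %/ k).+1.

Lemma size_decimate k u : size (decimate k u) = ((size u).-1 %/ k).+1.
Proof. exact: size_mkseq. Qed.

Lemma decimate_index_lt k u j : (0 < k)%N -> (0 < size u)%N ->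
  (j < size (decimate k u))%N -> (j * k < size u)%N.
Proof.
by move=> k0 u0; rewrite size_decimate ltnS leq_divRL // -ltnS prednK.
Qed.

Lemma nth_decimate k u j : (j < size (decimate k u))%N ->
  nth set0 (decimate k u) j = nth set0 u (j * k).
Proof. by rewrite size_decimate => ju; rewrite nth_mkseq. Qed.

Lemma size_decimate_ge k u : (0 < k)%N ->
  (size u <= size (decimate k u) * k)%N.
Proof.
move=> k0; rewrite size_decimate; case: (size u) => [|m] //=.
exact: ltn_ceil.
Qed.

Lemma strings_decimate U k u : (0 < k)%N ->
  strings U u -> strings U (decimate k u).
Proof.
move=> k0 [u0 Uu]; split => [|j ju]; first by rewrite size_decimate.
by rewrite nth_decimate //; apply: Uu; exact: decimate_index_lt.
Qed.

Lemma string_set_decimate f k u : (0 < k)%N -> (0 < size u)%N ->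
  string_set f u `<=` string_set (nds_power f k) (decimate k u).
Proof.
move=> k0 u0 x xu j ju; rewrite nth_decimate // nds_comp_power.
by apply: xu; exact: decimate_index_lt.
Qed.

Lemma string_covers_decimate f k K U N G : (0 < k)%N ->
  string_covers f K U (N * k) G ->
  string_covers (nds_power f k) K U N (decimate k @` G).
Proof.
move=> k0 [cG GU GN KG]; split.
- exact: card_le_trans (card_image_le _ _) cG.
- by move=> _ [u Gu <-]; apply: strings_decimate => //; exact: GU.
- move=> _ [u Gu <-]; rewrite -(leq_pmul2r k0).
  exact: leq_trans (GN u Gu) (size_decimate_ge _ _ k0).
- move=> x /KG[u Gu xu]; exists (decimate k u); first by exists u.
  by apply: string_set_decimate xu => //; exact: (GU u Gu).1.
Qed.

End decimation.

Section pesin_power.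
Context {R : realType} {X : topologicalType}.
Implicit Types (f : nat -> X -> X) (K : set X) (U : set (set X)) (s b : R).

Lemma decimate_weight_le s b k (u : seq (set X)) : 0 <= s -> 0 <= b ->
  (0 < k)%N ->
  expR (- b * (size (decimate k u))%:R `^ s)
    <= expR (- (b / k%:R `^ s) * (size u)%:R `^ s).
Proof.
move=> s0 b0 k0; rewrite ler_expR !mulNr lerN2 mulrAC.
have ks : 0 < k%:R `^ s :> R by rewrite powR_gt0 // ltr0n.
rewrite ler_pdivrMr // -mulrA ler_wpM2l // -powRM ?ler0n //.
rewrite ge0_ler_powR ?nnegrE ?mulr_ge0 ?ler0n // -natrM ler_nat.
exact: size_decimate_ge.
Qed.

Lemma pesin_m_nds_power_le f K U s b k : 0 <= s -> 0 <= b -> (0 < k)%N ->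
  (pesin_m (nds_power f k) K s U b <= pesin_m f K s U (b / k%:R `^ s))%E.
Proof.
move=> s0 b0 k0; apply: (@pesin_m_le _ _ _ _ _ _ _ _ 0) => N _.
apply: le_trans (pesin_M_le_m _ _ _ _ _ (N * k)).
apply: le_ereal_inf_tmp => _ [G GN <-].
apply: (@le_trans _ _ (\esum_(v in decimate k @` G)
    (expR (- b * (size v)%:R `^ s))%:E)%E).
  apply: ereal_inf_lbound; exists (decimate k @` G) => //.
  exact: string_covers_decimate.
apply: le_trans (esum_image_le _ _ _ _ _ _ _) _.
  by move=> u _; rewrite lee_fin expR_ge0.
by apply: le_esum => u _; rewrite lee_fin decimate_weight_le.
Qed.

Lemma pesin_D_cover_le0 f K U s b : 0 < s -> 0 < b ->
  (pesin_D_cover f K s U <= 0)%E -> pesin_m f K s U b = 0%E.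
Proof.
move=> s0 b0 D0.
have /ereal_inf_lt[_ [a /= ma <-]] : (pesin_D_cover f K s U < b%:E)%E.
  by apply: le_lt_trans D0 _; rewrite lte_fin.
by rewrite lte_fin => ab; apply: (pesin_m_eq0 s0 ab); rewrite ma ltry.
Qed.

Lemma pesin_D_nds_power_eq0 f K s k : K !=set0 -> 0 < s -> (0 < k)%N ->
  pesin_D f K s = 0%E -> pesin_D (nds_power f k) K s = 0%E.
Proof.
move=> K0 s0 k0 D0; apply/eqP; rewrite eq_le pesin_D_ge0 // andbT.
apply: ge_ereal_sup => _ [U cU <-].
apply/lee_addgt0Pr => b b0; rewrite add0e; apply: ereal_inf_lbound.
exists b => //=; apply/eqP; rewrite eq_le pesin_m_ge0 andbT.
have bk : 0 < b / k%:R `^ s by rewrite divr_gt0 ?powR_gt0 ?ltr0n.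
rewrite -(pesin_D_cover_le0 f K U s _ s0 bk).
  by apply: pesin_m_nds_power_le => //; exact: ltW.
by rewrite -D0; apply: ereal_sup_ubound; exists U.
Qed.

End pesin_power.

Theorem theorem3p16 (R : realType) (X : topologicalType) (f : nat -> X -> X)
    (K : set X) (k : nat) :
  compact [set: X] ->
  (forall n, continuous (f n)) ->
  K !=set0 ->
  (0 < k)%N ->
  (pesin_dim (R := R) (nds_power f k) K <= pesin_dim (R := R) f K)%E.
Proof.
move=> _ _ K0 k0; apply: ereal_inf_le_tmp => _ [s [s0 Ds] <-].
by exists s => //; split => //; exact: pesin_D_nds_power_eq0.
Qed.
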